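(* Let $a<b$ be real numbers, let $n\ge1$ be an integer, and let $f:[a,b]\to\mathbb{R}$ be such that $f^{(n)}$ is integrable with $\gamma_n\le f^{(n)}(x)\le\Gamma_n$ for all $x\in[a,b]$, where $\gamma_n,\Gamma_n\in\mathbb{R}$ are constants. (1) If $n$ is odd, then for all $\theta\in[0,1]$, $$|I-F_n|\le\frac{\Gamma_n-\gamma_n}{2}\,\frac{(b-a)^{n+1}}{(n+1)!\,2^n}\times\begin{cases}\theta(n+1)-1, & \text{if }\theta n\ge1,\\ 2\theta^{n+1}n^n-\theta(n+1)+1, & \text{if }0\le\theta n<1,\end{cases}$$ $$|I-F_n|\le\left[\frac{f^{(n-1)}(b)-f^{(n-1)}(a)}{b-a}-\gamma_n\right]\frac{(b-a)^{n+1}}{n!\,2^n}\,K_n(\theta),$$ and $$|I-F_n|\le\left[\Gamma_n-\frac{f^{(n-1)}(b)-f^{(n-1)}(a)}{b-a}\right]\frac{(b-a)^{n+1}}{n!\,2^n}\,K_n(\theta),$$ where $$K_n(\theta)=\begin{cases}\theta n-1, & \text{if }\theta n>\theta+1,\\ \theta^n(n-1)^{n-1}, & \text{if }1<\theta n\le\theta+1,\\ \max\{1-\theta n,\ \theta^n(n-1)^{n-1}\}, & \text{if }\theta n\le1.\end{cases}$$ (2) If $n=2m$ is even, then for all $\theta\in[0,1]$, $$\left|I-F_{2m}-\frac{(b-a)^{2m+1}}{(2m)!\,2^{2m}}\left(\frac1{2m+1}-\theta\right)\frac{f^{(2m-1)}(b)-f^{(2m-1)}(a)}{b-a}\right|\le\left[\frac{f^{(2m-1)}(b)-f^{(2m-1)}(a)}{b-a}-\gamma_{2m}\right]\frac{(b-a)^{2m+1}}{(2m)!\,2^{2m}}\,L_m(\theta)$$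 and $$\left|I-F_{2m}-\frac{(b-a)^{2m+1}}{(2m)!\,2^{2m}}\left(\frac1{2m+1}-\theta\right)\frac{f^{(2m-1)}(b)-f^{(2m-1)}(a)}{b-a}\right|\le\left[\Gamma_{2m}-\frac{f^{(2m-1)}(b)-f^{(2m-1)}(a)}{b-a}\right]\frac{(b-a)^{2m+1}}{(2m)!\,2^{2m}}\,L_m(\theta),$$ where $$L_m(\theta)=\begin{cases}\max\left\{\theta-\frac1{2m+1},\ \theta(2m-1)-\frac{2m}{2m+1}\right\}, & \text{if }\theta(2m-1)\ge1,\\ \max\left\{\left|\theta-\frac1{2m+1}\right|,\ \left|\theta(2m-1)-\frac{2m}{2m+1}\right|,\ \left|\theta-\frac1{2m+1}-\theta^{2m}(2m-1)^{2m-1}\right|\right\}, & \text{if }\theta(2m-1)<1.\end{cases}$$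
   Context: Notation: $I=\int_a^b f(x)\,dx$, and, for the parameter $\theta\in[0,1]$, $$F_n=(b-a)\left[(1-\theta)f\left(\tfrac{a+b}{2}\right)+\theta\,\tfrac{f(a)+f(b)}{2}\right]+\sum_{i=1}^{\lfloor (n-1)/2\rfloor}\frac{[1-\theta(2i+1)](b-a)^{2i+1}}{(2i+1)!\,2^{2i}}\,f^{(2i)}\left(\tfrac{a+b}{2}\right),$$ where $\lfloor\cdot\rfloor$ is the integer part and an empty sum is $0$. Convention: $(n-1)^{n-1}=1$ when $n=1$ (that is, $0^0=1$). $f^{(0)}=f$. *)

(* Defs.v *)
From HB Require Import structures.
From mathcomp Require Import all_boot all_order all_algebra.
From mathcomp Require Import all_classical all_reals all_analysis.

Set Implicit Arguments.
Unset Strict Implicit.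
Unset Printing Implicit Defensive.

Import Order.TTheory GRing.Theory Num.Theory.
Import numFieldNormedType.Exports.

Local Open Scope classical_set_scope.
Local Open Scope ring_scope.

(* A real function on a set A is represented by a total function whose values
   outside A are irrelevant.  The difference quotients below only see points
   of A, so that on a segment the derivatives at the endpoints are one-sided. *)
Definition diff_quot (R : realType) (f : R -> R) (x y : R) : R :=
  (f y - f x) / (y - x).

Definition derivable_within (R : realType) (A : set R) (f : R -> R) (x : R)
    : Prop :=
  cvg (diff_quot f x y @[y --> within A x^']).

Definition derive_within (R : realType) (A : set R) (f : R -> R) (x : R) : R :=
  lim (diff_quot f x y @[y --> within A x^']).

Definition deriven_within (R : realType) (A : set R) (n : nat) (f : R -> R)
    : R -> R :=
  iter n (derive_within A) f.

Definition derivablen_within (R : realType) (A : set R) (n : nat) (f : R -> R)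
    : Prop :=
  forall k : nat, (k < n)%N ->
    forall x : R, A x -> derivable_within A (deriven_within A k f) x.

Definition rule_F (R : realType) (a b : R) (n : nat) (f : R -> R) (theta : R)
    : R :=
  (b - a) * ((1 - theta) * f ((a + b) / 2) + theta * ((f a + f b) / 2))
  + \sum_(1 <= i < (n.-1 %/ 2).+1)
      (1 - theta * (2 * i + 1)%:R) * (b - a) ^+ (2 * i + 1)
        / ((2 * i + 1)`!%:R * 2 ^+ (2 * i))
      * deriven_within `[a, b] (2 * i) f ((a + b) / 2).

Definition coef_J (R : realType) (n : nat) (theta : R) : R :=
  if 1 <= theta * n%:R then theta * n.+1%:R - 1
  else 2 * theta ^+ n.+1 * n%:R ^+ n - theta * n.+1%:R + 1.

(* For n = 1 the factor n.-1%:R ^+ n.-1 is 0 ^+ 0 = 1. *)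
Definition coef_K (R : realType) (n : nat) (theta : R) : R :=
  if theta + 1 < theta * n%:R then theta * n%:R - 1
  else if 1 < theta * n%:R then theta ^+ n * n.-1%:R ^+ n.-1
  else Num.max (1 - theta * n%:R) (theta ^+ n * n.-1%:R ^+ n.-1).

Definition coef_L (R : realType) (m : nat) (theta : R) : R :=
  if 1 <= theta * (2 * m).-1%:R then
    Num.max (theta - 1 / (2 * m).+1%:R)
            (theta * (2 * m).-1%:R - (2 * m)%:R / (2 * m).+1%:R)
  else
    Num.max `|theta - 1 / (2 * m).+1%:R|
      (Num.max `|theta * (2 * m).-1%:R - (2 * m)%:R / (2 * m).+1%:R|
               `|theta - 1 / (2 * m).+1%:R
                 - theta ^+ (2 * m) * (2 * m).-1%:R ^+ (2 * m).-1|).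

(* Main.v *)
Require Import Defs.
From HB Require Import structures.
From mathcomp Require Import all_boot all_order all_algebra.
From mathcomp Require Import all_classical all_reals all_analysis.
From mathcomp Require Import ring lra.

Set Implicit Arguments.
Unset Strict Implicit.
Unset Printing Implicit Defensive.

Import Order.TTheory GRing.Theory Num.Theory.
Import numFieldNormedType.Exports.

Local Open Scope classical_set_scope.
Local Open Scope ring_scope.

(* Put h = (b - a) / 2, p_j(s) = s^j / j! - theta h s^(j-1) / (j-1)!, so that
   p_(j+1)' = p_j, and let D_0 be a primitive of f and D_(j+1) = f^(j).  Folding
   [a, b] around its midpoint, E_j(s) = D_j(a + s) - (-1)^j D_j(b - s) satisfies
   E_j' = E_(j+1) on ]0, h[.  Hence the function H = sum_(j <= n) (-1)^j p_j E_j
   has derivative (-1)^n p_n E_(n+1), and the values of the p_j at 0 and h give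
   H(h) - H(0) = I - F_n.
   As f^(n) is a bounded derivative, no integral of it is needed: each bound
   follows from the mean value theorem, in the form that |W'| <= Q' on ]0, h[
   implies |W(h) - W(0)| <= Q(h) - Q(0).  Here W is H or, when n is even, H
   minus a primitive of c E_(n+1) + 2 gamma (p_n - c), where c is the mean of
   p_n; and Q' is a bound for |p_n|, respectively |p_n - c|, times
   (f^(n)(a + s) - gamma) + (f^(n)(b - s) - gamma), and the same with Gamma.
   In the first bound of part (1), Q' = (Gamma - gamma) |p_n|.
   After rescaling to s = h y, the sup bounds for p_n come down to the tangent
   line inequality for powers. *)

(** * Primitives on a segment, the mean value inequality and integration by parts *)

(** Continuity on the closed segment with derivatives in the interior only is exactly what the mean
    value theorem asks for, and [f] may be any derivative, continuous or not. *)
Definition primitive_on (R : realType) (x y : R) (F f : R -> R) : Prop :=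
  {within `[x, y], continuous F} /\
  forall s, s \in `]x, y[ -> is_derive s 1 F (f s).

Section PrimitiveOn.
Variables (R : realType) (x y : R).
Implicit Types F G f g : R -> R.

Lemma eq_primitive_on F G f g : F =1 G -> {in `]x, y[, f =1 g} ->
  primitive_on x y F f -> primitive_on x y G g.
Proof.
by move=> /funext <- eqfg [cF dF]; split=> // s sxy; rewrite -eqfg //; exact: dF.
Qed.

Lemma primitive_on_poly (p : {poly R}) :
  primitive_on x y (horner p) (horner p^`()).
Proof.
split=> [|s _]; last exact: is_derive_poly.
by apply: continuous_subspaceT => s; exact: continuous_horner.
Qed.

Lemma primitive_onD F G f g : primitive_on x y F f -> primitive_on x y G g ->
  primitive_on x y (fun s => F s + G s) (fun s => f s + g s).
Proof.
move=> [cF dF] [cG dG]; split=> [|s sxy]; first exact: within_continuousD.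
by apply: is_deriveD; [exact: dF|exact: dG].
Qed.

Lemma primitive_onB F G f g : primitive_on x y F f -> primitive_on x y G g ->
  primitive_on x y (fun s => F s - G s) (fun s => f s - g s).
Proof.
move=> [cF dF] [cG dG]; split=> [|s sxy]; first exact: within_continuousB.
by apply: is_deriveB; [exact: dF|exact: dG].
Qed.

Lemma primitive_onM F G f g : primitive_on x y F f -> primitive_on x y G g ->
  primitive_on x y (fun s => F s * G s) (fun s => f s * G s + F s * g s).
Proof.
move=> [cF dF] [cG dG]; split=> [s|s sxy].
  by apply: continuousM; [exact: cF|exact: cG].
have dFs := dF _ sxy; have dGs := dG _ sxy.
apply: (is_derive_eq (is_deriveM dFs dGs)).
by rewrite addrC /GRing.scale /= mulrC.
Qed.

Lemma primitive_onZ c F f : primitive_on x y F f ->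
  primitive_on x y (fun s => c * F s) (fun s => c * f s).
Proof.
move=> pF; apply: eq_primitive_on (primitive_onM (primitive_on_poly c%:P) pF).
  by move=> s /=; rewrite hornerC.
by move=> s _ /=; rewrite derivC horner0 mul0r add0r hornerC.
Qed.

Lemma primitive_on_comp_affine (u v c d : R) F f :
  (forall s, s \in `[x, y] -> c * s + d \in `[u, v]) ->
  (forall s, s \in `]x, y[ -> c * s + d \in `]u, v[) ->
  primitive_on u v F f ->
  primitive_on x y (fun s => F (c * s + d)) (fun s => c * f (c * s + d)).
Proof.
move=> cl op [/subspace_continuousP cF dF]; split.
  apply/(subspace_continuousP `[x, y]) => s sxy.
  have cd : continuous (fun s : R => c * s + d).
    move=> r; apply: cvgD; [|exact: cvg_cst].
    by apply: cvgM; [exact: cvg_cst|exact: cvg_id].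
  move=> A /(cF _ (cl _ sxy)) /cd nA.
  have : \forall r \near s, c * r + d \in `[u, v] -> A (F (c * r + d)).
    exact: nA.
  by apply: filterS => r + rxy; apply; exact: cl.
move=> s sxy.
have dg : is_derive s (1 : R) (fun s : R => c * s + d) c.
  pose q := c *: 'X + d%:P.
  have -> : (fun s : R => c * s + d) = horner q.
    by apply/funext => r; rewrite !hornerE.
  apply: (is_derive_eq (is_derive_poly q s)).
  by rewrite derivD derivC derivZ derivX addr0 hornerZ hornerC mulr1.
have dFg := @is_derive1_comp _ F (fun s => c * s + d) s _ _ (dF _ (op _ sxy)) dg.
by apply: (is_derive_eq dFg); rewrite mulrC.
Qed.

End PrimitiveOn.

Lemma primitive_onS (R : realType) (x y u v : R) (F f : R -> R) :
  x <= u -> v <= y -> primitive_on x y F f -> primitive_on u v F f.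
Proof.
move=> xu vy [cF dF]; split=> [|s suv].
  by apply: continuous_subspaceW cF => s /=; rewrite !in_itv /=; lra.
by apply: dF; move: suv; rewrite !in_itv /=; lra.
Qed.

(** The derivatives of [G + F] and [G - F] are nonnegative inside the segment, so by the mean value
    theorem neither function decreases from [x] to [y]. *)
Lemma le_increment_primitive_on (R : realType) (x y : R) (F f G g : R -> R) :
  x <= y -> primitive_on x y F f -> primitive_on x y G g ->
  (forall s, s \in `]x, y[ -> `|f s| <= g s) -> `|F y - F x| <= G y - G x.
Proof.
have mono u H h : x < u -> primitive_on x u H h ->
    (forall s, s \in `]x, u[ -> 0 <= h s) -> H x <= H u.
  move=> xu [cH dH] h0; have [s sxu eqH] := MVT xu dH cH.
  by rewrite -subr_ge0 eqH mulr_ge0 ?h0// subr_ge0 ltW.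
rewrite le_eqVlt => /predU1P[<- _ _ _|xy pF pG fg].
  by rewrite !subrr normr0.
have := mono _ _ _ xy (primitive_onB pG pF).
have := mono _ _ _ xy (primitive_onD pG pF).
move=> H1 H2; rewrite ler_norml; apply/andP; split.
  suff : G x + F x <= G y + F y by lra.
  by apply: H1 => s /fg; rewrite ler_norml; lra.
suff : G x - F x <= G y - F y by lra.
by apply: H2 => s /fg; rewrite ler_norml; lra.
Qed.

(* The function on the left collects the boundary terms when
   [p n * E n.+1] is integrated by parts [n.+1] times. *)
Lemma primitive_on_by_parts (R : realType) (x y : R) (n : nat)
    (p : nat -> {poly R}) (E : nat -> R -> R) :
  (p 0)^`() = 0 -> (forall j, (p j.+1)^`() = p j) ->
  (forall j, (j <= n)%N -> primitive_on x y (E j) (E j.+1)) ->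
  primitive_on x y
    (fun s => \sum_(j < n.+1) (-1) ^+ j * ((p j).[s] * E j s))
    (fun s => (-1) ^+ n * ((p n).[s] * E n.+1 s)).
Proof.
move=> dp0 dpS; elim: n => [|n IHn] pE.
  have := primitive_onM (primitive_on_poly x y (p 0)) (pE 0 isT).
  apply: eq_primitive_on => [s|s _].
    by rewrite big_ord1 mul1r.
  by rewrite dp0 horner0 mul0r add0r mul1r.
have := primitive_onD (IHn (fun j le_jn => pE j (leqW le_jn)))
  (primitive_onZ ((-1) ^+ n.+1)
    (primitive_onM (primitive_on_poly x y (p n.+1)) (pE n.+1 (leqnn _)))).
apply: eq_primitive_on => [s|s _]; first by rewrite [RHS]big_ord_recr.
rewrite dpS exprS; ring.
Qed.

(** * Primitives obtained from one-sided derivatives and from integrals *)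

Lemma primitive_on_derive_within (R : realType) (a b : R) (g : R -> R) :
  (forall x, x \in `[a, b] -> derivable_within `[a, b] g x) ->
  primitive_on a b g (derive_within `[a, b] g).
Proof.
move=> dg; split.
  apply/(subspace_continuousP `[a, b]) => x xab.
  have dgx := dg _ xab.
  pose l := derive_within `[a, b] g x.
  (* Away from [x], [g y] is the difference quotient times [y - x], plus [g x]; the quotient
     converges, so [g y] tends to [g x]. *)
  have cvg_near : g y @[y --> within `[a, b] x^'] --> g x.
    have -> : g x = l * (x - x) + g x by rewrite subrr mulr0 add0r.
    have : diff_quot g x y * (y - x) + g x @[y --> within `[a, b] x^']
         --> l * (x - x) + g x.
      apply: cvgD; last exact: cvg_cst.
      apply: cvgM; first exact: dgx.
      apply: cvgB; last exact: cvg_cst.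
      by do 2 apply: cvg_within_filter; exact: cvg_id.
    apply: cvg_trans; apply: near_eq_cvg.
    have : \forall y \near x, y != x -> y \in `[a, b] ->
        diff_quot g x y * (y - x) + g x = g y.
      apply: (@nearW _ (nbhs x)) => y yx _.
      by rewrite /diff_quot divfK ?subrK// subr_eq0.
    by [].
  move=> A nA; have := cvg_near A nA.
  (* The punctured limit says nothing at [y = x], but there [A (g x)] holds since [A] is a
     neighbourhood of [g x]. *)
  suff : (\forall y \near x, y != x -> y \in `[a, b] -> A (g y)) ->
      \forall y \near x, y \in `[a, b] -> A (g y) by [].
  apply: filterS => y Ay yab; have [->|yx] := eqVneq y x.
    exact: nbhs_singleton.
  exact: Ay.
move=> x xab; have dgx : derivable_within `[a, b] g x.
  by apply: dg; exact: subset_itv_oo_cc.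
(* Near an interior point, membership in [[a, b]] is automatic, so the limit is two-sided; it
   remains to write it with the increment [h = y - x]. *)
have cvg_shift : h^-1 *: (g (h *: 1 + x) - g x) @[h --> 0^']
    --> derive_within `[a, b] g x.
  move=> A /dgx nA.
  have : \forall y \near x, y != x -> y \in `[a, b] -> A (diff_quot g x y).
    exact: nA.
  have : \forall y \near x, y \in `[a, b].
    by apply: filterS (near_in_itvoo xab) => y; exact: subset_itv_oo_cc.
  move=> near_ab near_A.
  have near_A' : \forall y \near x, y != x -> A (diff_quot g x y).
    by apply: filterS2 near_ab near_A => y yab + yx; apply.
  have : \forall h \near (0 : R), h + x != x -> A (diff_quot g x (h + x)).
    have cs : h + x @[h --> (0 : R)] --> x.
      rewrite -[X in _ --> X]add0r.
      by apply: cvgD; [exact: cvg_id|exact: cvg_cst].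
    exact: cs near_A'.
  have : (\forall h \near (0 : R), h != 0 -> A (h^-1 *: (g (h *: 1 + x) - g x)))
     -> (\forall h \near 0^', A (h^-1 *: (g (h *: 1 + x) - g x))) by [].
  move=> toA near_0; apply: toA; apply: filterS near_0 => h + h0.
  rewrite /diff_quot addrK /GRing.scale /= mulr1 mulrC; apply.
  by rewrite -subr_eq0 addrK.
apply: DeriveDef; first by apply/cvg_ex; eexists; exact: cvg_shift.
exact: cvg_lim cvg_shift.
Qed.

Lemma primitive_on_integral (R : realType) (a b : R) (g : R -> R) : a < b ->
  {within `[a, b], continuous g} ->
  primitive_on a b (fun x => \int[lebesgue_measure]_(t in `[a, x]) g t) g.
Proof.
move=> ab cg.
have ig : lebesgue_measure.-integrable `[a, b] (EFin \o g).
  by apply: continuous_compact_integrable => //; exact: segment_compact.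
split; first exact: (parameterized_integral_continuous (ltW ab) ig).
move=> x xab; move: (xab); rewrite in_itv /= => /andP[ax xb].
have [dG eqG] := continuous_FTC1_closed xb ig ax
  (within_continuous_continuous ab cg xab).
by rewrite -eqG derive1E; exact: derivableP.
Qed.

(** * Bounds on [0, 1] for the rescaled kernel *)

Section KernelBounds.
Variable R : realType.
Implicit Types (y z t theta : R) (k m n : nat).

(** Convexity of powers. In the induction, [t] times the bound for [k] exceeds the bound for [k.+1]
    by (k + 1) z^k (t - z)^2. *)
Lemma tangent_le_exprn z t k : 0 <= z -> 0 <= t ->
  z ^+ k.+1 + k.+1%:R * z ^+ k * (t - z) <= t ^+ k.+1.
Proof.
move=> z0 t0; elim: k => [|k IHk]; first by rewrite !expr1 expr0; lra.
have := ler_wpM2l t0 IHk; rewrite -exprS; apply: le_trans.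
have zk : 0 <= z ^+ k by exact: exprn_ge0.
rewrite -subr_ge0 [X in 0 <= X](_ : _ = k.+1%:R * z ^+ k * (t - z) ^+ 2).
  by rewrite mulr_ge0 ?sqr_ge0// mulr_ge0.
rewrite -[k.+2%:R]natr1 !exprS; ring.
Qed.

(* The minimum over [y >= 0], attained at [y = theta * k]. *)
Lemma kernel_ge y theta k : 0 <= y -> 0 <= theta ->
  - (theta ^+ k.+1 * k%:R ^+ k) <= y ^+ k * (y - theta * k.+1%:R).
Proof.
move=> y0 th0; case: k => [|k]; first by rewrite !expr0 expr1; lra.
have k0 : (0 : R) < k.+1%:R by rewrite ltr0n.
(* With y = (k + 1) z the claim is the tangent inequality from [z] to [theta], multiplied by (k +
   1)^(k + 1). *)
have [z z0 ->] : exists2 z : R, 0 <= z & y = k.+1%:R * z.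
  by exists (y / k.+1%:R); [rewrite divr_ge0|rewrite mulrC divfK// gt_eqF].
have := ler_wpM2r (exprn_ge0 k.+1 (ltW k0)) (tangent_le_exprn k.+1 z0 th0).
rewrite exprMn -[k.+2%:R]natr1 [z ^+ k.+2]exprS.
set Z := z ^+ k.+1; set K := k.+1%:R ^+ k.+1; set T := theta ^+ k.+2.
move=> H; lra.
Qed.

(** Here the minimum point theta k lies at or beyond 1, so the least value on [0, 1] is the one at y
    = 1. The tangent from [y] to 1 settles the case theta k = 1, and [h1] accounts for a larger
    [theta]. *)
Lemma kernel_ge_at1 y theta k : 0 <= y <= 1 -> 1 <= theta * k%:R ->
  1 - theta * k.+1%:R <= y ^+ k * (y - theta * k.+1%:R).
Proof.
move=> /andP[y0 y1] thk.
have k0 : (0 : R) < k%:R.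
  by case: k thk => [|k _]; rewrite ?ltr0n// mulr0 ler10.
have Y0 := exprn_ge0 k y0; have Y1 := exprn_ile1 k y0 y1.
have := tangent_le_exprn k y0 ler01.
rewrite expr1n exprS -natr1; move: (k%:R) (y ^+ k) thk k0 Y0 Y1 => K Y thk k0 Y0 Y1 tg.
rewrite -(ler_pM2l k0).
have h1 : 0 <= (theta * K - 1) * ((K + 1) * (1 - Y)).
  by apply: mulr_ge0; [lra|apply: mulr_ge0; lra].
nra.
Qed.

Lemma kernel_le y theta k : 0 <= y <= 1 ->
  y ^+ k * (y - theta * k.+1%:R) <= Num.max 0 (1 - theta * k.+1%:R).
Proof.
move=> /andP[y0 y1]; have Y0 := exprn_ge0 k y0; have Y1 := exprn_ile1 k y0 y1.
rewrite le_max; case: (leP y (theta * k.+1%:R)) => hy; apply/orP.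
  by left; nra.
by right; nra.
Qed.

(** The kernel vanishes at theta n and is least at theta (n - 1). In the first case of [coef_K] both
    points exceed 1, in the second only the zero does, so the kernel is nonpositive in both. In the
    third, the positive value at 1 competes with the depth of the minimum. *)
Lemma kernel_le_coef_K y theta n : (0 < n)%N -> 0 <= theta -> 0 <= y <= 1 ->
  `|y ^+ n.-1 * (y - theta * n%:R)| <= coef_K n theta.
Proof.
case: n => // k _ th0 y01; have /andP[y0 y1] := y01.
have lo := kernel_ge k y0 th0; have up := kernel_le theta k y01.
have lo1 := @kernel_ge_at1 y theta k y01.
rewrite /coef_K /= ler_norml; case: ifPn => [c1|_].
  have thk : 1 <= theta * k%:R by move: c1; rewrite -natr1; lra.
  have := lo1 thk; move: up; rewrite le_max; lra.
case: ifPn => [c2|_]; first by move: up; rewrite le_max; lra.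
set M := Num.max _ _.
have M1 : 1 - theta * k.+1%:R <= M by rewrite le_max lexx.
have M2 : theta ^+ k.+1 * k%:R ^+ k <= M by rewrite le_max lexx orbT.
have M0 : 0 <= M by apply: le_trans M2; rewrite mulr_ge0 ?exprn_ge0.
by move: up; rewrite le_max; lra.
Qed.

(** The number subtracted is the mean of the kernel over [0, 1]. Up to sign, the entries of [coef_L]
    are the centered values at 0, at 1 and at the minimum point theta (2m - 1). *)
Lemma centered_kernel_le_coef_L y theta m : (0 < m)%N -> 0 <= theta ->
  0 <= y <= 1 ->
  `|y ^+ (2 * m).-1 * (y - theta * (2 * m)%:R) - (1 / (2 * m).+1%:R - theta)|
    <= coef_L m theta.
Proof.
move=> m0 th0 y01; have /andP[y0 y1] := y01.
have n0 : (0 < 2 * m)%N by rewrite muln_gt0.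
rewrite /coef_L; case: (2 * m)%N n0 => // k _ /=.
have lo := kernel_ge k y0 th0; have up := kernel_le theta k y01.
have lo1 := @kernel_ge_at1 y theta k y01.
have kE : (k.+1%:R / k.+2%:R : R) = 1 - 1 / k.+2%:R.
  by rewrite -[X in X / _](addrK 1) natr1 mulrBl divff ?pnatr_eq0.
rewrite kE -[k.+1%:R]natr1 in up lo lo1 *.
set c := 1 / k.+2%:R in up lo lo1 *.
rewrite ler_norml; case: ifPn => [thk|_].
  have {}lo1 := lo1 thk; set M := Num.max _ _.
  have M1 : theta - c <= M by rewrite le_max lexx.
  have M2 : theta * k%:R - (1 - c) <= M by rewrite le_max lexx orbT.
  by move: up; rewrite le_max; lra.
set M := Num.max _ _.
have : `|theta - c| <= M by rewrite le_max lexx.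
have : `|theta * k%:R - (1 - c)| <= M by rewrite !le_max lexx orbT.
have : `|theta - c - theta ^+ k.+1 * k%:R ^+ k| <= M by rewrite !le_max lexx !orbT.
by rewrite !ler_norml; move: up; rewrite le_max; lra.
Qed.

End KernelBounds.

(** * The kernel polynomials and their boundary values *)

Section PeanoKernel.
Variables (R : realType) (d : R).

(* For [d = theta * h] this is, up to sign, the Peano kernel of the rule on each
   half of [a, b], as a function of the distance to the nearer endpoint. *)
Definition peano_kernel (j : nat) : {poly R} :=
  if j is i.+1 then j`!%:R^-1 *: 'X^j - (d / i`!%:R) *: 'X^i else 1.

Lemma deriv_peano_kernel0 : (peano_kernel 0)^`() = 0.
Proof. exact: derivC. Qed.

Lemma deriv_peano_kernelS j : (peano_kernel j.+1)^`() = peano_kernel j.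
Proof.
rewrite /= derivB !derivZ !derivXn.
have scale_fact i : i.+1`!%:R^-1 *: ('X^i *+ i.+1) = i`!%:R^-1 *: 'X^i :> {poly R}.
  rewrite -['X^i *+ _]scaler_nat scalerA factS natrM invfM mulrAC.
  by rewrite mulVf ?mul1r ?pnatr_eq0.
rewrite scale_fact; case: j => [|i] /=.
  by rewrite mulr0n scaler0 subr0 expr0 invr1 scale1r.
by rewrite -!(scalerA d) scale_fact scalerA.
Qed.

Lemma peano_kernelSE j s :
  (peano_kernel j.+1).[s] = s ^+ j / j.+1`!%:R * (s - d * j.+1%:R).
Proof.
rewrite /= !hornerE factS natrM exprS.
have : (j`!%:R : R) != 0 by rewrite pnatr_eq0 -lt0n fact_gt0.
have : (j.+1%:R : R) != 0 by rewrite pnatr_eq0.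
by move: (j.+1%:R) (j`!%:R) => A B A0 B0; field; rewrite A0 B0.
Qed.

Lemma peano_kernelMr j theta h : d = theta * h ->
  (peano_kernel j).[h] = h ^+ j / j`!%:R * (1 - theta * j%:R).
Proof.
move=> dE; case: j => [|j].
  by rewrite /= hornerE expr0 fact0 invr1 mulr0 subr0 !mulr1.
by rewrite peano_kernelSE dE exprS; ring.
Qed.

Lemma peano_kernelS0 j : (peano_kernel j.+1).[0] = if j == 0 then - d else 0.
Proof.
rewrite peano_kernelSE; case: j => [|j]; last by rewrite expr0n /= !mul0r.
by rewrite expr0 /= invr1; ring.
Qed.

End PeanoKernel.

(** * The quadrature error as the increment of one function *)

Lemma sum_odd_terms (R : ringType) (c : nat -> R) (n : nat) :
  \sum_(0 <= j < n | odd j) c j = \sum_(0 <= i < n./2) c (2 * i + 1)%N.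
Proof.
elim: n => [|n IHn]; first by rewrite !big_geq.
rewrite big_mkcond big_nat_recr //= -big_mkcond IHn uphalf_half.
case: ifPn => [odd_n|_]; last by rewrite add0n addr0.
rewrite add1n big_nat_recr //=; congr (_ + c _).
by rewrite mul2n addn1 -[LHS]odd_double_half odd_n.
Qed.

Section QuadratureError.
Variables (R : realType) (a b : R) (n : nat) (f : R -> R).
Hypotheses (lt_ab : a < b) (n_gt0 : (0 < n)%N)
  (derivable_f : derivablen_within `[a, b] n f).

Let h : R := (b - a) / 2.
Let c : R := (a + b) / 2.
Let D (j : nat) (x : R) : R :=
  if j is i.+1 then deriven_within `[a, b] i f x
  else \int[lebesgue_measure]_(t in `[a, x]) f t.

Let primitive_on_D j : (j <= n)%N -> primitive_on a b (D j) (D j.+1).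
Proof.
have pf i : (i < n)%N -> primitive_on a b (D i.+1) (D i.+2).
  by move=> lt_in; apply: primitive_on_derive_within; exact: derivable_f.
case: j => [_|j]; last exact: pf.
by apply: primitive_on_integral => //; have [] := pf 0 n_gt0.
Qed.

Lemma primitive_on_left_half F g : primitive_on a b F g ->
  primitive_on 0 h (fun s => F (a + s)) (fun s => g (a + s)).
Proof.
move=> pF; have : primitive_on 0 h (fun s => F (1 * s + a))
    (fun s => 1 * g (1 * s + a)).
  by apply: primitive_on_comp_affine pF => s; rewrite !in_itv /= /h; move: lt_ab; lra.
by apply: eq_primitive_on => [s|s _]; rewrite !mul1r addrC.
Qed.

Lemma primitive_on_right_half F g : primitive_on a b F g ->
  primitive_on 0 h (fun s => F (b - s)) (fun s => - g (b - s)).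
Proof.
move=> pF; have : primitive_on 0 h (fun s => F (-1 * s + b))
    (fun s => -1 * g (-1 * s + b)).
  by apply: primitive_on_comp_affine pF => s; rewrite !in_itv /= /h; move: lt_ab; lra.
by apply: eq_primitive_on => [s|s _]; rewrite !mulN1r addrC.
Qed.

Lemma rule_F_error theta : exists2 H : R -> R,
  primitive_on 0 h H (fun s => (-1) ^+ n * ((peano_kernel (theta * h) n).[s] *
    (deriven_within `[a, b] n f (a + s)
     + (-1) ^+ n * deriven_within `[a, b] n f (b - s)))) &
  H h - H 0 = \int[lebesgue_measure]_(x in `[a, b]) f x - rule_F a b n f theta.
Proof.
pose E j s := D j (a + s) - (-1) ^+ j * D j (b - s).
have pE j : (j <= n)%N -> primitive_on 0 h (E j) (E j.+1).
  move=> /primitive_on_D pD; have := primitive_onB (primitive_on_left_half pD)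
    (primitive_onZ ((-1) ^+ j) (primitive_on_right_half pD)).
  apply: eq_primitive_on => // s _.
  by rewrite /E exprS; ring.
have pH := primitive_on_by_parts (deriv_peano_kernel0 (theta * h))
  (deriv_peano_kernelS (theta * h)) pE.
eexists.
  apply: eq_primitive_on pH => // s _.
  by rewrite /E exprS /=; ring.
have ahc : a + h = c by rewrite /h /c; lra.
have bhc : b - h = c by rewrite /h /c; lra.
have D0a : D 0 a = 0 by rewrite /D set_itv1 Rintegral_set1.
(* At 0 only the kernels of index 0 and 1 are nonzero; they give the integral and the endpoint
   values. *)
have -> : \sum_(j < n.+1) (-1) ^+ j * ((peano_kernel (theta * h) j).[0] * E j 0)
    = - D 0 b + theta * h * (f a + f b).
  clear pE pH; case: n n_gt0 => // k _; rewrite 2!big_ord_recl big1 => [|j _].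
    rewrite [X in X.[0]]/= peano_kernelS0 hornerC /E !addr0 !subr0 D0a [in LHS]/=.
    rewrite (_ : bump 0 0 = 1%N) //.
    by rewrite expr0 expr1 /=; ring.
  by rewrite peano_kernelS0 /= mul0r mulr0.
pose T j := 2 * (h ^+ j / j`!%:R * (1 - theta * j%:R)) * D j c.
(* At [h] both arguments of [E j] are the midpoint, so even terms cancel and odd ones double. *)
have -> : \sum_(j < n.+1) (-1) ^+ j * ((peano_kernel (theta * h) j).[h] * E j h)
    = - \sum_(0 <= i < n.+1./2) T (2 * i + 1)%N.
  rewrite -sum_odd_terms [in RHS]big_mkcond [in RHS]big_mkord -sumrN.
  apply: eq_bigr => j _.
  rewrite (@peano_kernelMr _ _ j theta h erefl) /E ahc bhc /T -signr_odd.
  by case: (odd j); ring.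
(* One more term than in the sum of [rule_F]: the extra one, i = 0, is the midpoint value of [f]. *)
have -> : n.+1./2 = (n.-1 %/ 2).+1 by rewrite divn2; case: n n_gt0.
rewrite big_nat_recl // /rule_F big_add1.
have -> : \sum_(0 <= i < n.-1 %/ 2) T (2 * i.+1 + 1)%N =
    \sum_(0 <= i < (n.-1 %/ 2).+1.-1)
      (1 - theta * (2 * i.+1 + 1)%:R) * (b - a) ^+ (2 * i.+1 + 1) /
      ((2 * i.+1 + 1)`!%:R * 2 ^+ (2 * i.+1)) *
      deriven_within `[a, b] (2 * i.+1) f ((a + b) / 2).
  apply: eq_bigr => i _; rewrite /T addn1 /= -/c /h expr_div_n.
  rewrite [2 ^+ _.+1]exprS !invfM.
  have field_eq (x y z u v : R) :
      2 * (x * (2^-1 * y) * z * u) * v = u * x * (z * y) * v by field.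
  exact: field_eq.
rewrite /T /D muln0 add0n /= -/c /h expr1 !invr1.
by field.
Qed.

End QuadratureError.

(** * From pointwise kernel bounds to bounds on increments *)

Lemma weighted_error_le (R : realType) (h M gam : R) (W w Q q : R -> R) :
  0 <= h -> primitive_on 0 h W w -> primitive_on 0 h Q q ->
  (forall s, s \in `]0, h[ -> `|w s| <= M * (q s - 2 * gam)) ->
  `|W h - W 0| <= M * (Q h - Q 0 - 2 * gam * h).
Proof.
move=> h0 pW pQ wq.
pose L s := ((2 * gam) *: 'X : {poly R}).[s].
have pL : primitive_on 0 h L (fun _ => 2 * gam).
  apply: eq_primitive_on (primitive_on_poly 0 h ((2 * gam) *: 'X)) => // s _.
  by rewrite derivZ derivX hornerZ hornerC mulr1.
have := le_increment_primitive_on h0 pW (primitive_onZ M (primitive_onB pQ pL)) wq.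
by rewrite /L !hornerE -mulrBr; congr (_ <= M * _); ring.
Qed.

Section KernelOnInterval.
Variables (R : realType) (h theta : R) (n : nat).
Hypotheses (h_gt0 : 0 < h) (n_gt0 : (0 < n)%N) (theta_ge0 : 0 <= theta).

Let p : {poly R} := peano_kernel (theta * h) n.

Lemma peano_kernel_scaled y :
  p.[h * y] = h ^+ n / n`!%:R * (y ^+ n.-1 * (y - theta * n%:R)).
Proof.
rewrite /p; case: n n_gt0 => // k _.
by rewrite peano_kernelSE exprMn exprS /=; ring.
Qed.

Let unit_scale s : s \in `]0, h[ -> exists2 y, 0 <= y <= 1 & s = h * y.
Proof.
rewrite in_itv /= => /andP[s0 sh]; exists (s / h).
  by rewrite divr_ge0 ?(ltW s0) ?(ltW h_gt0)//= ler_pdivrMr// mul1r ltW.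
by rewrite mulrC divfK// gt_eqF.
Qed.

Lemma peano_kernel_le_coef_K s : s \in `]0, h[ ->
  `|p.[s]| <= h ^+ n / n`!%:R * coef_K n theta.
Proof.
move=> /unit_scale[y y01 ->]; rewrite peano_kernel_scaled.
have k0 : 0 <= h ^+ n / n`!%:R by rewrite divr_ge0// exprn_ge0// ltW.
by rewrite normrM (ger0_norm k0) ler_wpM2l// kernel_le_coef_K.
Qed.

Lemma peano_kernel_le_coef_L m s : n = (2 * m)%N -> s \in `]0, h[ ->
  `|p.[s] - h ^+ n / n`!%:R * (1 / n.+1%:R - theta)|
    <= h ^+ n / n`!%:R * coef_L m theta.
Proof.
move=> nE /unit_scale[y y01 ->]; rewrite peano_kernel_scaled -mulrBr.
have k0 : 0 <= h ^+ n / n`!%:R by rewrite divr_ge0// exprn_ge0// ltW.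
rewrite normrM (ger0_norm k0) ler_wpM2l// nE centered_kernel_le_coef_L//.
by move: n_gt0; rewrite nE muln_gt0.
Qed.

(* If [theta * n < 1], the kernel changes sign at [theta * n * h] only. *)
Lemma weighted_error_le_coef_J (W w : R -> R) (K : R) : 0 <= K ->
  primitive_on 0 h W w ->
  (forall s, s \in `]0, h[ -> `|w s| <= K * `|p.[s]|) ->
  `|W h - W 0| <= K * (h ^+ n.+1 / n.+1`!%:R * coef_J n theta).
Proof.
move=> K0 pW wp.
have pP x y : primitive_on x y (horner (peano_kernel (theta * h) n.+1)) (horner p).
  rewrite /p -(deriv_peano_kernelS _ n); exact: primitive_on_poly.
have P0 : (peano_kernel (theta * h) n.+1).[0] = 0.
  by rewrite peano_kernelS0; case: n n_gt0.
have Ph := peano_kernelMr n.+1 (erefl (theta * h)).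
have pE s : p.[s] = s ^+ n.-1 / n`!%:R * (s - theta * h * n%:R).
  by rewrite /p; case: n n_gt0 => // k _; rewrite peano_kernelSE.
rewrite /coef_J; case: ifPn => [thn|].
  (* The zero of [p] is at or beyond [h], so |p| = - p on the whole interval and has the primitive -
     p_(n+1). *)
  have := le_increment_primitive_on (ltW h_gt0) pW (primitive_onZ (- K) (pP 0 h)).
  rewrite P0 Ph mulr0 subr0 mulNr -mulrN -mulrN opprB; apply => s sh.
  apply: le_trans (wp s sh) _; rewrite mulNr -mulrN ler_wpM2l//.
  move: sh; rewrite in_itv /= => /andP[s0 sh].
  rewrite ler0_norm// pE mulr_ge0_le0 ?divr_ge0 ?exprn_ge0 ?(ltW s0)//.
  by have := ler_wpM2l (ltW h_gt0) thn; lra.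
rewrite -ltNge => thn.
(* Split at the zero of [p]: |p| is - p on the left of [z] and p on the right, so the value of
   p_(n+1) at [z] enters twice. This gives the factor 2 in [coef_J]. *)
pose z := theta * h * n%:R.
have z0 : 0 <= z by rewrite !mulr_ge0// ltW.
have zh : z <= h by have := ler_wpM2l (ltW h_gt0) (ltW thn); rewrite /z; lra.
have pWl : primitive_on 0 z W w by exact: primitive_onS pW.
have pWr : primitive_on z h W w by exact: primitive_onS pW.
have Hl := le_increment_primitive_on z0 pWl (primitive_onZ (- K) (pP 0 z)).
have Hr := le_increment_primitive_on zh pWr (primitive_onZ K (pP z h)).
have Pz : (peano_kernel (theta * h) n.+1).[z] =
    - (h ^+ n.+1 / n.+1`!%:R * (theta ^+ n.+1 * n%:R ^+ n)).
  rewrite peano_kernelSE /z !exprMn !exprS -natr1; ring.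
rewrite P0 Pz in Hl; rewrite Pz Ph in Hr.
rewrite (_ : W h - W 0 = (W z - W 0) + (W h - W z)); last by ring.
apply: le_trans (ler_normD _ _) _.
have {}Hl : `|W z - W 0| <= K * (h ^+ n.+1 / n.+1`!%:R * (theta ^+ n.+1 * n%:R ^+ n)).
  rewrite mulr0 subr0 mulNr mulrN opprK in Hl; apply: Hl => s.
  rewrite in_itv /= => /andP[s0 sz].
  apply: le_trans (wp s _) _; first by rewrite in_itv /= s0 (lt_le_trans sz).
  rewrite mulNr -mulrN ler_wpM2l// ler0_norm// pE.
  by rewrite mulr_ge0_le0 ?divr_ge0 ?exprn_ge0 ?(ltW s0)// subr_le0 ltW.
have {}Hr := Hr _.
apply: le_trans (lerD Hl (Hr _)) _ => [s|].
  rewrite in_itv /= => /andP[zs sh].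
  apply: le_trans (wp s _) _; first by rewrite in_itv /= sh (le_lt_trans z0).
  rewrite ler_wpM2l// ger0_norm// pE.
  have s0 : 0 <= s by rewrite (le_trans z0)// ltW.
  by rewrite mulr_ge0 ?divr_ge0 ?exprn_ge0// subr_ge0 ltW.
rewrite le_eqVlt; apply/orP; left; apply/eqP; ring.
Qed.

End KernelOnInterval.

(** * The error estimates *)

Theorem theorem7 (R : realType) (a b : R) (n : nat) (f : R -> R)
    (gamma Gamma : R) :
  a < b -> (1 <= n)%N ->
  derivablen_within `[a, b] n f ->
  lebesgue_measure.-integrable `[a, b]
    (EFin \o deriven_within `[a, b] n f) ->
  (forall x : R, a <= x <= b ->
     gamma <= deriven_within `[a, b] n f x <= Gamma) ->
  (odd n -> forall theta : R, 0 <= theta <= 1 ->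
     [/\ `|\int[lebesgue_measure]_(x in `[a, b]) f x - rule_F a b n f theta|
           <= (Gamma - gamma) / 2
              * ((b - a) ^+ n.+1 / (n.+1`!%:R * 2 ^+ n))
              * coef_J n theta,
         `|\int[lebesgue_measure]_(x in `[a, b]) f x - rule_F a b n f theta|
           <= ((deriven_within `[a, b] n.-1 f b
                - deriven_within `[a, b] n.-1 f a) / (b - a) - gamma)
              * ((b - a) ^+ n.+1 / (n`!%:R * 2 ^+ n))
              * coef_K n theta
       & `|\int[lebesgue_measure]_(x in `[a, b]) f x - rule_F a b n f theta|
           <= (Gamma - (deriven_within `[a, b] n.-1 f b
                        - deriven_within `[a, b] n.-1 f a) / (b - a))
              * ((b - a) ^+ n.+1 / (n`!%:R * 2 ^+ n))
              * coef_K n theta])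
  /\
  (forall m : nat, n = (2 * m)%N -> forall theta : R, 0 <= theta <= 1 ->
     `|\int[lebesgue_measure]_(x in `[a, b]) f x - rule_F a b (2 * m) f theta
       - (b - a) ^+ (2 * m).+1 / ((2 * m)`!%:R * 2 ^+ (2 * m))
         * (1 / (2 * m).+1%:R - theta)
         * ((deriven_within `[a, b] (2 * m).-1 f b
             - deriven_within `[a, b] (2 * m).-1 f a) / (b - a))|
       <= ((deriven_within `[a, b] (2 * m).-1 f b
            - deriven_within `[a, b] (2 * m).-1 f a) / (b - a) - gamma)
          * ((b - a) ^+ (2 * m).+1 / ((2 * m)`!%:R * 2 ^+ (2 * m)))
          * coef_L m theta
     /\
     `|\int[lebesgue_measure]_(x in `[a, b]) f x - rule_F a b (2 * m) f theta
       - (b - a) ^+ (2 * m).+1 / ((2 * m)`!%:R * 2 ^+ (2 * m))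
         * (1 / (2 * m).+1%:R - theta)
         * ((deriven_within `[a, b] (2 * m).-1 f b
             - deriven_within `[a, b] (2 * m).-1 f a) / (b - a))|
       <= (Gamma - (deriven_within `[a, b] (2 * m).-1 f b
                    - deriven_within `[a, b] (2 * m).-1 f a) / (b - a))
          * ((b - a) ^+ (2 * m).+1 / ((2 * m)`!%:R * 2 ^+ (2 * m)))
          * coef_L m theta).
Proof.
move=> lt_ab n_gt0 df _ bnd.
pose h := (b - a) / 2.
have h0 : 0 < h by rewrite /h; lra.
pose u s := deriven_within `[a, b] n f (a + s).
pose v s := deriven_within `[a, b] n f (b - s).
pose g := deriven_within `[a, b] n.-1 f.
have pg : primitive_on a b g (deriven_within `[a, b] n f).
  rewrite [deriven_within _ n f](_ : _ = derive_within `[a, b] g).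
    by apply: primitive_on_derive_within; apply: df; rewrite prednK.
  by rewrite -[in LHS](prednK n_gt0).
have pQ : primitive_on 0 h (fun s => g (a + s) - g (b - s))
    (fun s => u s + v s).
  have := primitive_onB (primitive_on_left_half lt_ab pg)
    (primitive_on_right_half lt_ab pg).
  by apply: eq_primitive_on => // s _; rewrite opprK.
have pQN : primitive_on 0 h (fun s => g (b - s) - g (a + s))
    (fun s => - (u s + v s)).
  by apply: eq_primitive_on (primitive_onZ (-1) pQ) => [s|s _]; ring.
have mid : b - h = a + h by rewrite /h; lra.
have uv_bnd s : s \in `]0, h[ ->
    (gamma <= u s <= Gamma) /\ (gamma <= v s <= Gamma).
  by rewrite in_itv /= /h => s0h; split; apply: bnd; lra.
pose Delta := g b - g a.
have ab2 : b - a = 2 * h by rewrite /h; lra.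
(* The two halves meet at the midpoint, so g(a + s) - g(b - s) is 0 at [h] and increases by [Delta]
   in all; subtracting 2 gamma h leaves (b - a) times the mean of f^(n) minus gamma. The bound with
   [Gamma] is the same for the opposite function. *)
have error_le W w M : primitive_on 0 h W w ->
    ((forall s, s \in `]0, h[ -> `|w s| <= M * (u s + v s - 2 * gamma)) ->
     `|W h - W 0| <= (Delta / (b - a) - gamma) * ((b - a) * M)) /\
    ((forall s, s \in `]0, h[ -> `|w s| <= M * (2 * Gamma - (u s + v s))) ->
     `|W h - W 0| <= (Gamma - Delta / (b - a)) * ((b - a) * M)).
  move=> pW; set d := Delta / (b - a).
  have dE : g b = g a + d * (2 * h).
    by rewrite -ab2 divfK ?subr_eq0 ?gt_eqF// addrC subrK.
  split=> wM; rewrite ab2.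
    have := weighted_error_le (ltW h0) pW pQ wM.
    by rewrite mid subr0 addr0 dE; congr (_ <= _); ring.
  have {}wM s : s \in `]0, h[ -> `|w s| <= M * (- (u s + v s) - 2 * (- Gamma)).
    by move=> /wM; congr (_ <= M * _); ring.
  have := weighted_error_le (ltW h0) pW pQN wM.
  by rewrite mid subr0 addr0 dE; congr (_ <= _); ring.
have pow_ab k : (b - a) ^+ k = 2 ^+ k * h ^+ k.
  by rewrite -exprMn ab2.
have scaleE : (b - a) ^+ n.+1 / (n`!%:R * 2 ^+ n) = (b - a) * (h ^+ n / n`!%:R).
  rewrite exprS pow_ab; have : (2 : R) ^+ n != 0 by rewrite expf_neq0// pnatr_eq0.
  have : (n`!%:R : R) != 0 by rewrite pnatr_eq0 -lt0n fact_gt0.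
  by move: (n`!%:R) (2 ^+ n) (h ^+ n) => A B C A0 B0; field; rewrite A0 B0.
have assoc (x y z t : R) : x * (y * z) * t = x * (y * (z * t)) by rewrite !mulrA.
have err theta := rule_F_error lt_ab n_gt0 df theta.
split=> [odd_n theta /andP[th0 _]|m nE theta /andP[th0 _]].
  have [H pH <-] := err theta; rewrite -/h in pH *.
  pose p := peano_kernel (theta * h) n.
  have {}pH : primitive_on 0 h H (fun s => - (p.[s] * (u s - v s))).
    apply: eq_primitive_on pH => // s _.
    by rewrite -signr_odd odd_n expr1 /u /v; ring.
  have [Kg KG] := error_le _ _ (h ^+ n / n`!%:R * coef_K n theta) pH.
  have pM s : s \in `]0, h[ -> `|p.[s]| <= h ^+ n / n`!%:R * coef_K n theta.
    exact: peano_kernel_le_coef_K.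
  split.
  (* Here |u - v| <= Gamma - gamma is a constant weight on |p|. *)
  - rewrite (_ : _ / 2 * _ = (Gamma - gamma) * (h ^+ n.+1 / n.+1`!%:R)); last first.
      rewrite pow_ab exprS; have : (2 : R) ^+ n != 0 by rewrite expf_neq0// pnatr_eq0.
      have : (n.+1`!%:R : R) != 0 by rewrite pnatr_eq0 -lt0n fact_gt0.
      by move: (n.+1`!%:R) (2 ^+ n) (h ^+ n.+1) => A B C A0 B0; field; rewrite A0 B0.
    rewrite -mulrA; apply: (weighted_error_le_coef_J h0 n_gt0 th0 _ pH) => [|s sh].
      by have := bnd a; rewrite lexx (ltW lt_ab); lra.
    have [ub vb] := uv_bnd s sh; rewrite normrN normrM mulrC ler_wpM2r//.
    by rewrite ler_norml; lra.
  (* Here |u - v| <= (u - gamma) + (v - gamma); the next bound uses (Gamma - u) + (Gamma - v). *)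
  - rewrite scaleE assoc; apply: Kg => s sh; have [ub vb] := uv_bnd s sh.
    by rewrite normrN normrM ler_pM ?pM// ler_norml; lra.
  - rewrite scaleE assoc; apply: KG => s sh; have [ub vb] := uv_bnd s sh.
    by rewrite normrN normrM ler_pM ?pM// ler_norml; lra.
have [H pH eqH] := err theta; rewrite -/h in pH eqH.
rewrite -nE -eqH; pose p := peano_kernel (theta * h) n.
pose c := h ^+ n / n`!%:R * (1 / n.+1%:R - theta).
have even_n : odd n = false by rewrite nE oddM.
have {}pH : primitive_on 0 h H (fun s => p.[s] * (u s + v s)).
  apply: eq_primitive_on pH => // s _.
  by rewrite -signr_odd even_n expr0 /u /v; ring.
(* A primitive of [p - c]. It vanishes at both 0 and [h] because [c] is the mean of [p] on
   [0, h]. *)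
pose P : {poly R} := peano_kernel (theta * h) n.+1 - c *: 'X.
have dP : P^`() = p - c%:P.
  by rewrite derivB deriv_peano_kernelS derivZ derivX alg_polyC.
have P0 : P.[0] = 0.
  rewrite hornerD hornerN peano_kernelS0 !hornerE.
  by move: n_gt0; case: (n) => // k _; rewrite subr0.
have Ph : P.[h] = 0.
  rewrite hornerD hornerN (peano_kernelMr n.+1 (erefl (theta * h))) hornerZ hornerX /c.
  have : (n`!%:R : R) != 0 by rewrite pnatr_eq0 -lt0n fact_gt0.
  have : (n.+1%:R : R) != 0 by rewrite pnatr_eq0.
  rewrite factS natrM exprS; move: (n`!%:R) (n.+1%:R) (h ^+ n) => A B C A0 B0.
  by field; rewrite A0 B0.
(* Subtracting 2 kappa P leaves the increment unchanged, but makes the derivative factor as (p - c)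
   (u + v - 2 kappa), whose second factor has constant sign for kappa = gamma or Gamma. *)
have pW kappa := primitive_onB (primitive_onB pH (primitive_onZ c pQ))
  (primitive_onZ (2 * kappa) (primitive_on_poly 0 h P)).
have incr kappa : (H h - c * (g (a + h) - g (b - h)) - 2 * kappa * P.[h])
    - (H 0 - c * (g (a + 0) - g (b - 0)) - 2 * kappa * P.[0])
    = H h - H 0 - (b - a) ^+ n.+1 / (n`!%:R * 2 ^+ n) * (1 / n.+1%:R - theta)
        * ((g b - g a) / (b - a)).
  rewrite P0 Ph mid addr0 subr0 scaleE /c.
  have : b - a != 0 by rewrite subr_eq0 gt_eqF.
  by move: (b - a) (_ / n`!%:R) (1 / n.+1%:R) => A B C A0; field.
have pM s : s \in `]0, h[ -> `|p.[s] - c| <= h ^+ n / n`!%:R * coef_L m theta.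
  exact: peano_kernel_le_coef_L.
have wE kappa s : p.[s] * (u s + v s) - c * (u s + v s) - 2 * kappa * P^`().[s]
    = (p.[s] - c) * (u s + v s - 2 * kappa).
  by rewrite dP hornerD hornerN hornerC; ring.
split.
- have [+ _] := error_le _ _ (h ^+ n / n`!%:R * coef_L m theta) (pW gamma).
  rewrite incr scaleE (assoc _ _ _ (coef_L _ _)); apply=> s sh.
  have [ub vb] := uv_bnd s sh.
  by rewrite wE normrM ler_pM ?pM// ger0_norm//; lra.
- have [_ +] := error_le _ _ (h ^+ n / n`!%:R * coef_L m theta) (pW Gamma).
  rewrite incr scaleE (assoc _ _ _ (coef_L _ _)); apply=> s sh.
  have [ub vb] := uv_bnd s sh.
  by rewrite wE normrM ler_pM ?pM// ler0_norm; lra.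
Qed.
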